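(* Let $\mathcal{T}$ be a locally compact, $\sigma$-compact Hausdorff space, $\mu$ a finite positive Radon measure on $\mathcal{T}$ with $\mu(\mathcal{T})>0$, $1\le p<\infty$ and $q$ the conjugate exponent. For $\varepsilon>1$ let $S_{\varepsilon}^{p}=\{f\in L^{q}_{\mu}(\mathcal{T})\text{ real-valued}:\|f\|_q\le\varepsilon,\ \int f\,d\mu=\mu(\mathcal{T})^{1/p}\}$ and $L^{p}(\mathcal{T})_{\varepsilon}^{+}=\{g\in L^{p}_{\mu}(\mathcal{T})\text{ real-valued}:\int gf\,d\mu\ge0\ \forall f\in S_{\varepsilon}^{p}\}$. Let $L^{p}(\mathcal{T})_{+}$ be the cone of $\mu$-a.e. nonnegative functions in $L^p_\mu(\mathcal{T})$. Then there exists $\varepsilon>1$ such that the cones $L^{p}(\mathcal{T})_{+}$ and $L^{p}(\mathcal{T})_{\varepsilon}^{+}$ are comparable (one contains the other) if and only if $\operatorname{supp}(\mu)$ is finite.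
   Context: $L^p_\mu(\mathcal{T})$ is a unital $\ast$-normed space (involution = complex conjugation) with unit $e_p=\mu(\mathcal{T})^{-1/p}1$, dual $L^q_\mu(\mathcal{T})$ via $\langle g,f\rangle=\int gf\,d\mu$; the set $S_\varepsilon^p$ is the set of unital hermitian functionals of norm at most $\varepsilon$, and $L^{p}(\mathcal{T})_{\varepsilon}^{+}$ is the associated projective cone. *)

(* Defs.v *)
From HB Require Import structures.
From mathcomp Require Import all_boot all_order all_algebra.
From mathcomp Require Import all_classical all_reals all_analysis.
Set Implicit Arguments. Unset Strict Implicit. Unset Printing Implicit Defensive.
Import Order.TTheory GRing.Theory Num.Theory.
Local Open Scope classical_set_scope.
Local Open Scope ring_scope.

Definition borelT (T : ptopologicalType) : Type := g_sigma_algebraType (@open T).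

Definition sigma_compact (T : topologicalType) : Prop :=
  exists K : nat -> set T, (forall n, compact (K n)) /\ \bigcup_n K n = setT.

(* (finite) Radon measure : inner regular by compact sets on all Borel sets
   (for a finite measure this also yields outer regularity by open sets) *)
Definition radon_measure (R : realType) (T : ptopologicalType)
    (mu : {measure set (borelT T) -> \bar R}) : Prop :=
  forall A : set (borelT T), measurable A ->
    mu A = ereal_sup [set mu K | K in [set K : set (borelT T) |
                                       @compact T K /\ K `<=` A]].

Definition msupp (R : realType) (T : ptopologicalType)
    (mu : {measure set (borelT T) -> \bar R}) : set T :=
  [set x : T | forall U : set T, open U -> U x -> (0 < mu U)%E].

Definition conj_exp (R : realType) (p : R) : \bar R :=
  if p == 1 then +oo%E else (p / (p - 1))%:E.

Definition inL (R : realType) (T : ptopologicalType)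
    (mu : {measure set (borelT T) -> \bar R}) (r : \bar R)
    (f : borelT T -> R) : Prop :=
  measurable_fun setT f /\ (Lnorm mu r (EFin \o f) < +oo)%E.

Definition S_eps (R : realType) (T : ptopologicalType)
    (mu : {measure set (borelT T) -> \bar R}) (p eps : R) : set (borelT T -> R) :=
  [set f | inL mu (conj_exp p) f /\
           (Lnorm mu (conj_exp p) (EFin \o f) <= eps%:E)%E /\
           (\int[mu]_x (f x)%:E = ((fine (mu setT)) `^ p^-1)%:E)%E].

Definition Lp_cone_eps (R : realType) (T : ptopologicalType)
    (mu : {measure set (borelT T) -> \bar R}) (p eps : R) : set (borelT T -> R) :=
  [set g | inL mu p%:E g /\
           forall f, S_eps mu p eps f -> (0 <= \int[mu]_x (g x * f x)%:E)%E].

Definition Lp_pos (R : realType) (T : ptopologicalType)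
    (mu : {measure set (borelT T) -> \bar R}) (p : R) : set (borelT T -> R) :=
  [set g | inL mu p%:E g /\ {ae mu, forall x, 0 <= g x}].

Definition comparable_sets (U : Type) (A B : set U) : Prop :=
  A `<=` B \/ B `<=` A.

(* Main.v *)
Require Import Defs.
From HB Require Import structures.
From mathcomp Require Import all_boot all_order all_algebra.
From mathcomp Require Import all_classical all_reals all_analysis.
From mathcomp Require Import measurable_realfun ess_sup_inf ring lra.
Import Order.TTheory GRing.Theory Num.Theory.
Local Open Scope classical_set_scope.
Local Open Scope ring_scope.

(** If the support is finite, [mu] lives on finitely many atoms, and for [eps]
    large enough [S_eps] contains the normalized indicators of all of them, so
    testing against [S_eps] detects nonnegativity.

    If the support is infinite, there are sets [A] of arbitrarily small positive
    measure. For such [A], [S_eps] contains a step function that is negative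
    exactly on [A], so the indicator of [A] is nonnegative but not in the
    [eps]-cone; conversely [1 - 2 * \1_A] is not nonnegative, but by Hoelder's
    inequality it still pairs nonnegatively with [S_eps]. *)

(** * Null sets, norm bounds and Hoelder estimates *)

Lemma negligible_bigcup_seq d (T : measurableType d) (R : realType)
    (mu : {measure set T -> \bar R}) (I : eqType) (s : seq I) (F : I -> set T) :
  (forall i, i \in s -> mu.-negligible (F i)) ->
  mu.-negligible (\bigcup_(i in [set` s]) F i).
Proof.
elim: s => [|i s IHs] F0.
  by apply: negligibleS (negligible_set0 mu) => x [].
apply: (@negligibleS _ _ _ _ (F i `|` \bigcup_(j in [set` s]) F j)).
  move=> x [j /=]; rewrite in_cons => /predU1P[-> | js] Fx; first by left.
  by right; exists j.
apply: negligibleU; first by apply: F0; rewrite mem_head.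
by apply: IHs => j js; apply: F0; rewrite in_cons js orbT.
Qed.

Lemma Lnorm_le_bound d (T : measurableType d) (R : realType)
    (mu : {measure set T -> \bar R}) (r C : R) (f : T -> R) :
  0 < r -> 0 <= C -> measurable_fun setT f -> (forall x, `|f x| <= C) ->
  (Lnorm mu r%:E (EFin \o f) <= C%:E * poweR (mu setT) r^-1)%E.
Proof.
move=> r0 C0 mf fC; rewrite unlock.
(* With [C] moved inside the root, monotonicity of the root leaves only a comparison of
   integrals. *)
have -> : (C%:E * poweR (mu setT) r^-1 =
           poweR ((C `^ r)%:E * mu setT) r^-1)%E.
  rewrite poweRM ?lee_fin ?powR_ge0// poweR_EFin -powRrM mulfV ?gt_eqF//.
  by rewrite powRr1.
apply: gt0_ler_poweR; rewrite ?invr_ge0 ?(ltW r0)//.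
- by rewrite in_itv/= leey andbT; apply: integral_ge0 => x _;
    rewrite lee_fin powR_ge0.
- by rewrite in_itv/= leey andbT mule_ge0// lee_fin powR_ge0.
- rewrite -integral_cst//; apply: ge0_le_integral => //.
  + by move=> x _; exact: poweR_ge0.
  + apply/measurable_EFinP.
    apply: (@measurableT_comp _ _ _ _ _ _ (@powR R ^~ r)) => //=.
    exact: measurableT_comp.
  + move=> x _; rewrite /= lee_fin.
    by apply: ge0_ler_powR; rewrite ?nnegrE ?(ltW r0).
Qed.

(** The exponent [1 - p^-1] is the reciprocal of the conjugate exponent, also for [p = 1], where it
    is 0 and the bound reads [C]. One formula thus serves finite and infinite conjugate
    exponents. *)
Lemma Lnorm_conj_exp_le_bound d (T : measurableType d) (R : realType)
    (mu : {measure set T -> \bar R}) (p C : R) (f : T -> R) :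
  1 <= p -> 0 <= C -> measurable_fun setT f -> (forall x, `|f x| <= C) ->
  (Lnorm mu (conj_exp p) (EFin \o f) <= C%:E * poweR (mu setT) (1 - p^-1))%E.
Proof.
move=> p1 C0 mf fC; rewrite /conj_exp; case: eqVneq => [->|pn1].
  rewrite invr1 subrr poweRe0 mule1 unlock.
  case: ifPn => _; last by rewrite lee_fin.
  by apply/ess_supP/nearW => x /=; rewrite lee_fin.
have p1' : 1 < p by rewrite lt_neqAle eq_sym pn1.
have p0 : 0 < p by exact: lt_trans p1'.
have -> : 1 - p^-1 = (p / (p - 1))^-1.
  by rewrite invf_div mulrBl mul1r divff// gt_eqF.
by apply: Lnorm_le_bound => //; rewrite divr_gt0// subr_gt0.
Qed.

(** Hoelder's inequality for [f] against [\1_A]; for [p = 1] it is the bound of [f] by its essential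
    supremum. *)
Lemma integral_abse_le_Lnorm d (T : measurableType d) (R : realType)
    (mu : {measure set T -> \bar R}) (p : R) (f : T -> R) (A : set T) :
  1 <= p -> measurable_fun setT f -> measurable A ->
  (\int[mu]_(x in A) `|(f x)%:E| <=
   poweR (mu A) p^-1 * Lnorm mu (conj_exp p) (EFin \o f))%E.
Proof.
move=> p1 mf mA; rewrite /conj_exp; case: eqVneq => [->|pn1].
  rewrite invr1 poweRe1// muleC.
  apply: integral_le_bound => //; [|exact: Lnorm_ge0|].
    exact/measurable_EFinP/measurable_funTS.
  (* The norm of infinite exponent is the essential supremum only if the space has positive mass;
     otherwise the whole space is null and any almost everywhere bound holds. *)
  have [mu0|mu0] := ltP 0%E (mu setT).
    rewrite unlock mu0.
    have := ess_sup_ge mu (abse \o (EFin \o f)).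
    by apply: filterS => x + _; exact.
  exists setT; split => //.
  by apply/eqP; rewrite eq_le mu0/=.
have p1' : 1 < p by rewrite lt_neqAle eq_sym pn1.
have p0 : 0 < p by exact: lt_trans p1'.
have q0 : 0 < p / (p - 1) by rewrite divr_gt0// subr_gt0.
have pq : p^-1 + (p / (p - 1))^-1 = 1.
  by rewrite invf_div -{1}(div1r p) -mulrDl subrKC mulfV// gt_eqF.
have mA1 : measurable_fun setT (\1_A : T -> R) by exact: measurable_indic.
have := hoelder mu mA1 mf p0 q0 pq.
rewrite Lnorm1 (integral_mkcond A) => hAf.
have -> : poweR (mu A) p^-1 = Lnorm mu p%:E (EFin \o \1_A).
  have {1}-> : mu A = (\int[mu]_x (\1_A x)%:E)%E.
    by rewrite integral_indic// setIT.
  rewrite unlock; congr poweR.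
  apply: eq_integral => x _ /=.
  rewrite indicE; case: (x \in A) => /=; rewrite ?normr1 ?powR1//.
  by rewrite normr0 powR0// gt_eqF.
apply: le_trans hAf; rewrite le_eqVlt; apply/orP; left; apply/eqP.
apply: eq_integral => x _; rewrite patchE /= indicE.
by case: (x \in A); rewrite ?mul1r// mul0r normr0.
Qed.

(** * Borel sets and the support of a Radon measure *)

Lemma borel_open (T : ptopologicalType) (U : set T) :
  open U -> measurable (U : set (borelT T)).
Proof. exact: sub_gen_smallest. Qed.

Lemma borel_closed (T : ptopologicalType) (F : set T) :
  closed F -> measurable (F : set (borelT T)).
Proof.
move=> cF; rewrite -[F]setCK; apply: (@measurableC _ (borelT T)).
by apply: borel_open; exact: closed_openC.
Qed.

Lemma borel_set1 (T : ptopologicalType) (x : T) :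
  hausdorff_space T -> measurable ([set x] : set (borelT T)).
Proof.
move=> hT; apply: borel_closed.
exact/accessible_closed_set1/hausdorff_accessible.
Qed.

Section radon.
Context (R : realType) (T : ptopologicalType).
Variable mu : {measure set (borelT T) -> \bar R}.
Hypothesis hT : hausdorff_space T.
Hypothesis mu_radon : radon_measure mu.

Lemma msuppCP (x : T) :
  ~ msupp mu x -> exists U : set T, [/\ open U, U x & mu U = 0%E].
Proof.
move=> /existsNP[U] /not_implyP[oU] /not_implyP[Ux] /negP.
rewrite -leNgt => mU0; exists U; split => //.
by apply/eqP; rewrite eq_le mU0/=.
Qed.

Lemma open_msuppC : open (~` msupp mu).
Proof.
rewrite openE => x /msuppCP[U [oU Ux U0]].
apply: (@filterS _ _ _ U); last exact: open_nbhs_nbhs.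
by move=> y Uy /(_ U oU Uy); rewrite U0 ltxx.
Qed.

(** By inner regularity it suffices that each compact subset of the complement is null, and finitely
    many null open sets cover it. *)
Lemma msuppC_negligible : mu.-negligible (~` msupp mu).
Proof.
have mS : measurable (~` msupp mu : set (borelT T)).
  by apply: borel_open; exact: open_msuppC.
suff : (mu (~` msupp mu) <= 0)%E.
  by rewrite measure_le0 => /eqP mS0; apply/negligibleP.
rewrite (mu_radon _ mS); apply: ge_ereal_sup => _ [K [cK KS] <-].
have mK : measurable K by apply: borel_closed; exact: compact_closed.
rewrite (_ : mu K = 0%E)//; apply/negligibleP => //.
have /choice[U hU] (x : T) : exists U : set T,
    ~ msupp mu x -> [/\ open U, U x & mu U = 0%E].
  have [xS|/msuppCP[U hU]] := pselect (msupp mu x); first by exists set0.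
  by exists U.
move: cK; rewrite compact_cover => /(_ T (~` msupp mu) U) [].
- by move=> x /hU[].
- by move=> x /KS xS; exists x => //; have [] := hU x xS.
move=> D DS KD; apply: (@negligibleS _ (borelT T) _ _ _ _ KD).
apply: (@negligible_bigcup_seq _ (borelT T)) => x /DS.
rewrite inE => /hU[oU _ U0]; apply/negligibleP => //; exact: borel_open.
Qed.

(* Inner regularity of [~` [set x]] produces a compact set whose complement is
   an open neighbourhood of [x] of measure close to that of [[set x]]. *)
Lemma msupp_small_measure (delta : R) :
  (mu setT < +oo)%E -> infinite_set (msupp mu) -> 0 < delta ->
  exists A : set (borelT T),
    [/\ measurable A, (0 < mu A)%E & (mu A < delta%:E)%E].
Proof.
move=> mu_fin infS delta0; apply: contrapT => noA.
(* Assuming the contrary, no measure lies strictly between 0 and [delta]; every point of the support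
   is then an atom of mass at least [delta]. *)
have big (A : set (borelT T)) :
    measurable A -> (0 < mu A)%E -> (delta%:E <= mu A)%E.
  move=> mA A0; rewrite leNgt; apply/negP => Ad.
  by apply: noA; exists A.
have fin (A : set (borelT T)) : measurable A -> mu A \is a fin_num.
  move=> mA; rewrite ge0_fin_numE//; apply: le_lt_trans mu_fin.
  by apply: le_measure; rewrite ?inE.
have atom (x : T) : msupp mu x -> (delta%:E <= mu [set x])%E.
  move=> Sx; have mx := borel_set1 _ x hT.
  have mxC : measurable (~` [set x] : set (borelT T)) by exact: measurableC.
  have : (mu (~` [set x]) <= mu setT - delta%:E)%E.
    rewrite (mu_radon _ mxC); apply: ge_ereal_sup => _ [K [cK KS] <-].
    have clK : closed K by exact: compact_closed.
    have mK : measurable K by exact: borel_closed.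
    rewrite leeBrDr// -(setvU K) measureU//; last 2 first.
    - exact: measurableC.
    - by rewrite setICl.
    rewrite addeC leeD2r//; apply: big; first exact: measurableC.
    by apply: (Sx (~` K)) => [|/KS]; [exact: closed_openC|exact].
  rewrite leeBrDr// -(setvU [set x]) measureU//; last by rewrite setICl.
  by rewrite leeD2lE// fin.
(* So many atoms in the infinite support would together outweigh the finite total mass. *)
have [n nP] : exists n : nat, (mu setT < (n%:R * delta)%:E)%E.
  rewrite -(fineK (fin _ measurableT)).
  exists (Num.truncn (fine (mu setT) / delta)).+1.
  by rewrite lte_fin -ltr_pdivrMr// truncnS_gt.
have [B BS nB] := infinite_set_fset n infS.
have : (mu setT < ((size (finmap.enum_fset B))%:R * delta)%:E)%E.
  by apply: lt_le_trans nP _; rewrite lee_fin ler_pM2r// ler_nat.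
apply/negP; rewrite -leNgt.
suff H (s : seq T) : uniq s -> (forall x, x \in s -> msupp mu x) ->
    measurable ([set` s] : set (borelT T)) /\
    (((size s)%:R * delta)%:E <= mu [set` s])%E.
  have [mB] := H _ (finmap.fset_uniq B) BS; move=> /le_trans; apply.
  by apply: le_measure; rewrite ?inE.
elim: s => [_ _|x s IHs /= /andP[xs us] sS].
  rewrite mul0r; split => //.
  by rewrite (_ : [set` [::]] = set0)//; apply/seteqP; split => x.
have [|ms IH] := IHs us.
  by move=> y ys; apply: sS; rewrite in_cons ys orbT.
have mx := borel_set1 _ x hT.
have -> : [set` x :: s] = [set x] `|` [set` s].
  by apply/seteqP; split => y /=; rewrite in_cons => /predU1P.
split; first exact: measurableU.
rewrite measureU//; last first.
  by apply/seteqP; split => y //= [->]; rewrite (negbTE xs).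
rewrite mulrS mulrDl mul1r EFinD leeD//.
by apply/atom/sS; rewrite mem_head.
Qed.

End radon.

(** * Step functions and bounded functions for a finite measure *)

Section bounded_functions.
Context d (T : measurableType d) (R : realType).
Variable mu : {measure set T -> \bar R}.
Hypothesis mu_fin : (mu setT < +oo)%E.

Lemma fine_measureK (A : set T) : measurable A -> (fine (mu A))%:E = mu A.
Proof.
move=> mA; rewrite fineK// ge0_fin_numE//; apply: le_lt_trans mu_fin.
by apply: le_measure; rewrite ?inE.
Qed.

Lemma measurable_affine_indic (a b : R) (A : set T) : measurable A ->
  measurable_fun setT (fun x => a + b * \1_A x : R).
Proof.
move=> mA; apply: measurable_funD; first exact: measurable_cst.
apply: measurable_funM; first exact: measurable_cst.
exact: measurable_indic.
Qed.

Lemma integral_affine_indic (a b : R) (A : set T) : measurable A ->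
  (\int[mu]_x (a + b * \1_A x)%:E =
   (a * fine (mu setT) + b * fine (mu A))%:E)%E.
Proof.
move=> mA.
have icst : mu.-integrable setT (EFin \o cst a).
  apply/integrableP; split; first exact/measurable_EFinP.
  rewrite (eq_integral (cst `|a|%:E))// integral_cst// -fine_measureK//.
  by rewrite -EFinM ltry.
have iA : mu.-integrable setT (fun x => (\1_A x)%:E).
  apply/integrableP; split; first exact/measurable_EFinP/measurable_indic.
  rewrite (eq_integral (fun x => (\1_A x)%:E)); last first.
    by move=> x _; rewrite gee0_abs// lee_fin.
  by rewrite integral_indic// setIT -fine_measureK// ltry.
under eq_integral do rewrite EFinD EFinM.
rewrite integralD//; last exact: integrableZl.
rewrite integralZl// integral_indic// setIT integral_cst//.
by rewrite EFinD !EFinM !fine_measureK.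
Qed.

End bounded_functions.

Lemma inL_bound (R : realType) (T : ptopologicalType)
    (mu : {measure set (borelT T) -> \bar R}) (p C : R) (g : borelT T -> R) :
  (mu setT < +oo)%E -> 1 <= p -> 0 <= C -> measurable_fun setT g ->
  (forall x, `|g x| <= C) -> inL mu p%:E g.
Proof.
move=> mu_fin p1 C0 mg gC; split => //.
apply: le_lt_trans (Lnorm_le_bound _ _ _ _ _ _ _ _ C0 mg gC) _.
  exact: lt_le_trans p1.
by rewrite -fine_measureK// poweR_EFin -EFinM ltry.
Qed.

(** * Finite support: one inclusion of the cones *)

Lemma finite_msupp_cone_sub (R : realType) (T : ptopologicalType)
    (mu : {measure set (borelT T) -> \bar R}) (p : R) :
  hausdorff_space T -> (mu setT < +oo)%E -> radon_measure mu -> 1 <= p ->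
  finite_set (msupp mu) ->
  exists eps : R, 1 < eps /\ Lp_cone_eps mu p eps `<=` Lp_pos mu p.
Proof.
move=> hT mu_fin mu_radon p1 /finite_seqP[s suppE].
(* This weight gives [f x] the integral required in [S_eps] when [x] is an atom; at a point of mass
   zero, division by zero makes it 0. *)
pose w x := (fine (mu setT)) `^ p^-1 / fine (mu [set x]).
pose f x : borelT T -> R := fun y => w x * \1_[set x] y.
have w0 x : 0 <= w x by rewrite divr_ge0 ?powR_ge0 ?fine_ge0.
have m1 x : measurable ([set x] : set (borelT T)) by exact: borel_set1.
have mf x : measurable_fun setT (f x).
  by apply: measurable_funM => //; exact: measurable_indic.
have f_le x y : `|f x y| <= w x.
  rewrite /f normrM ger0_norm// indicE.
  by case: (y \in _); rewrite ?normr1 ?normr0 ?mulr1 ?mulr0.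
have f_lty x : (Lnorm mu (conj_exp p) (EFin \o f x) < +oo)%E.
  apply: (le_lt_trans (Lnorm_conj_exp_le_bound _ _ _ _ _ _ _ p1 (w0 x) _ _))
    => //.
  by rewrite -fine_measureK// poweR_EFin -EFinM ltry.
pose N x := fine (Lnorm mu (conj_exp p) (EFin \o f x)).
have N0 x : 0 <= N x by rewrite fine_ge0// Lnorm_ge0.
(* The sum dominates [N x] for each [x] in [s], and the summand 2 makes the value exceed 1. *)
exists (2 + \sum_(x <- s) N x); split.
  by rewrite ltr_wpDr ?sumr_ge0// ltr1n.
move=> g [gL gS]; split => //.
have g0 x : x \in s -> mu [set x] != 0%E -> 0 <= g x.
  move=> xs x0.
  have mux0 : 0 < fine (mu [set x]).
    by rewrite lt0r fine_ge0// andbT -eqe fine_measureK.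
  have : S_eps mu p (2 + \sum_(x <- s) N x) (f x).
    split; [by split|split].
      rewrite -[leLHS]fineK ?ge0_fin_numE ?Lnorm_ge0// lee_fin -/(N x).
      rewrite (big_rem x)//= addrCA lerDl addr_ge0//.
      by rewrite sumr_ge0.
    under eq_integral do rewrite -[f x _]add0r.
    rewrite integral_affine_indic// mul0r add0r divfK// gt_eqF//.
  move=> /gS.
  (* Pairing [g] with [f x] gives [g x] times a positive constant. *)
  rewrite (eq_integral (fun y : borelT T =>
    (0 + g x * w x * \1_([set x] : set (borelT T)) y)%:E)); last first.
    move=> y _; rewrite /f add0r !indicE.
    have [/set_mem/= ->|] := boolP (y \in [set x]); first by rewrite !mulr1.
    by rewrite !mulr0.
  rewrite integral_affine_indic// lee_fin mul0r add0r -mulrA divfK ?gt_eqF//.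
  rewrite pmulr_lge0// powR_gt0//; apply: lt_le_trans mux0 _.
  by rewrite -lee_fin !fine_measureK//; apply: le_measure; rewrite ?inE.
apply: (@negligibleS _ (borelT T) _ _ (~` msupp mu `|`
    \bigcup_(x in [set` s]) [set y : borelT T | y = x /\ ~ 0 <= g y])).
  move=> y /= gy; have [|Sy] := pselect (msupp mu y); last by left.
  by rewrite suppE => ys; right; exists y.
apply: negligibleU; first exact: msuppC_negligible.
apply: negligible_bigcup_seq => x xs.
have [x0|x0] := eqVneq (mu [set x]) 0%E.
  apply: (@negligibleS _ (borelT T) _ _ [set x]); first by move=> y [].
  exact/negligibleP.
apply: negligibleS (negligible_set0 mu) => y [-> /=].
by rewrite g0.
Qed.

(** * Both inclusions fail in the presence of a small set of positive measure *)

Section small_sets.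
Context (R : realType) (T : ptopologicalType).
Variables (mu : {measure set (borelT T) -> \bar R}) (p eps : R).
Variable A : set (borelT T).
Hypotheses (mu_fin : (mu setT < +oo)%E) (p1 : 1 <= p).
Hypotheses (mA : measurable A) (A0 : (0 < mu A)%E).
Let m := fine (mu setT).
Let a := fine (mu A).

Let a_gt0 : 0 < a.
Proof. by rewrite -lte_fin fine_measureK. Qed.

Let p_gt0 : 0 < p. Proof. exact: lt_le_trans p1. Qed.

(** The test function is [kappa * alpha] off [A] and [- kappa] on [A], so it pairs with [\1_A] to
    [- kappa * a]. The first hypothesis says [alpha <= eps]. *)
Lemma Lp_pos_not_sub_cone : a * (eps + 1) <= m * (eps - 1) -> 1 < eps ->
  ~ Lp_pos mu p `<=` Lp_cone_eps mu p eps.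
Proof.
move=> a_small eps1 sub.
have a0 := a_gt0.
have am : a < m.
  rewrite ltNge; apply/negP => ma.
  have : m * (eps - 1) <= a * (eps - 1) by rewrite ler_wpM2r//; lra.
  by nra.
have m0 : 0 < m by exact: lt_trans am.
(* [alpha] solves [alpha * (m - a) - a = m], which fixes the integral of [f]; [kappa] rescales so
   that this integral is [m] to the power [p^-1] and the norm bound is [alpha]. *)
pose alpha := (m + a) / (m - a).
pose kappa := m `^ (p^-1 - 1).
have ma0 : 0 < m - a by rewrite subr_gt0.
have alphaE : alpha * (m - a) = m + a by rewrite /alpha divfK// gt_eqF.
have alpha1 : 1 <= alpha by rewrite ler_pdivlMr//; lra.
have alpha_eps : alpha <= eps by rewrite ler_pdivrMr//; nra.
have kappa0 : 0 < kappa by exact: powR_gt0.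
have kappam : kappa * m = m `^ p^-1.
  by rewrite mulrC mulr_powRB1// ?invr_gt0// ltW.
pose f : borelT T -> R :=
  fun x => kappa * alpha + - (kappa * (alpha + 1)) * \1_A x.
have mf : measurable_fun setT f by exact: measurable_affine_indic.
have f_le x : `|f x| <= kappa * alpha.
  by rewrite ler_norml /f indicE; case: (x \in A) => /=; nra.
have Nf : (Lnorm mu (conj_exp p) (EFin \o f) <= eps%:E)%E.
  apply: le_trans (Lnorm_conj_exp_le_bound _ _ _ _ _ _ _ p1 _ mf f_le) _.
    by rewrite mulr_ge0// ltW// (lt_le_trans ltr01).
  rewrite -fine_measureK// poweR_EFin -EFinM lee_fin -/m.
  rewrite (_ : _ * _ = alpha)// mulrAC /kappa -powRD; last first.
    by rewrite (gt_eqF m0) implybT.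
  by rewrite addrC subrKA subrr powRr0 mul1r.
have Sf : S_eps mu p eps f.
  split; first by split => //; apply: le_lt_trans Nf (ltry _).
  split => //; rewrite /f integral_affine_indic// -/m -/a -kappam.
  congr EFin; transitivity (kappa * (alpha * (m - a) - a)); first by ring.
  by rewrite alphaE addrK.
have [|_ /(_ f Sf)] := sub (\1_A).
  split; last by apply: aeW => x; rewrite indicE.
  apply: (@inL_bound _ _ _ _ 1) => // x.
  by rewrite indicE; case: (x \in A); rewrite ?normr1 ?normr0.
rewrite (eq_integral (fun x => (0 + - kappa * \1_A x)%:E)); last first.
  move=> x _; congr EFin; rewrite /f indicE; case: (x \in A) => /=; ring.
by rewrite integral_affine_indic// lee_fin -/a mul0r add0r; nra.
Qed.

Lemma cone_not_sub_Lp_pos : a * (2 * eps) `^ p <= m -> 1 < eps ->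
  ~ Lp_cone_eps mu p eps `<=` Lp_pos mu p.
Proof.
move=> a_small eps1 sub.
have m0 : 0 <= m by rewrite fine_ge0.
pose g : borelT T -> R := fun x => 1 + - 2 * \1_A x.
have mg : measurable_fun setT g by exact: measurable_affine_indic.
have gL : inL mu p%:E g.
  apply: (@inL_bound _ _ _ _ 1) => // x.
  by rewrite ler_norml /g indicE; case: (x \in A) => /=; lra.
have key : a `^ p^-1 * (2 * eps) <= m `^ p^-1.
  have e0 : 0 <= 2 * eps by lra.
  have -> : a `^ p^-1 * (2 * eps) = (a * (2 * eps) `^ p) `^ p^-1.
    rewrite [RHS]powRM ?powR_ge0 ?(ltW a_gt0)// -[in RHS]powRrM.
    by rewrite mulfV ?gt_eqF// powRr1.
  apply: ge0_ler_powR; rewrite ?nnegrE ?invr_ge0 ?(ltW p_gt0)//.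
  by rewrite mulr_ge0 ?powR_ge0// ltW.
have /sub[_ [B [mB B0 AB]]] : Lp_cone_eps mu p eps g.
  split => // f [[mf f_lty] [fN fI]].
  have fi : mu.-integrable setT (EFin \o f).
    apply/integrableP; split; first exact/measurable_EFinP.
    apply: le_lt_trans (integral_abse_le_Lnorm _ _ _ mu _ _ _ p1 mf _) _ => //.
    rewrite -fine_measureK// poweR_EFin.
    by rewrite lte_mul_pinfty// lee_fin powR_ge0.
  have fAi : mu.-integrable A (EFin \o f).
    exact: (integrableS measurableT).
  have fAi' : mu.-integrable setT ((EFin \o f) \_ A).
    by rewrite -integrable_mkcond.
  have -> : (\int[mu]_x (g x * f x)%:E =
             \int[mu]_x (f x)%:E - 2%:E * \int[mu]_(x in A) (f x)%:E)%E.
    rewrite (integral_mkcond A) -integralZl// -integralB//; last first.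
      exact: integrableZl.
    apply: eq_integral => x _; rewrite /g indicE patchE.
    case: (x \in A) => /=; rewrite -?EFinM -?EFinB; congr EFin; ring.
  have := le_abse_integral mu mA (measurable_int mu fAi).
  have := integral_abse_le_Lnorm _ _ _ mu _ _ _ p1 mf mA.
  rewrite fI => le1 /le_trans /(_ le1) le2.
  have {}le2 : (`|\int[mu]_(x in A) (f x)%:E| <= (a `^ p^-1 * eps)%:E)%E.
    apply: le_trans le2 _; rewrite -fine_measureK// poweR_EFin EFinM.
    by rewrite lee_wpmul2l// lee_fin powR_ge0.
  move: le2; case: (\int[mu]_(x in A) (f x)%:E)%E => [r||]//=.
  rewrite !lee_fin ler_norml => /andP[_ r_le].
  by rewrite -/m; lra.
(* Since [g] equals -1 on [A], the null set [B] where nonnegativity may fail contains [A]. *)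
suff : mu A = 0%E by apply/eqP; rewrite gt_eqF.
apply/eqP; rewrite eq_le measure_ge0 andbT -B0.
apply: le_measure; rewrite ?inE// => x Ax; apply: AB => /=.
by rewrite /g indicE mem_set//=; lra.
Qed.

End small_sets.

Theorem theorem5p6 (R : realType) (T : ptopologicalType)
    (mu : {measure set (borelT T) -> \bar R}) (p : R) :
  locally_compact [set: T] -> sigma_compact T -> hausdorff_space T ->
  (mu setT < +oo)%E -> radon_measure mu -> (0 < mu setT)%E ->
  1 <= p ->
  (exists eps : R, 1 < eps /\ comparable_sets (Lp_pos mu p) (Lp_cone_eps mu p eps))
  <-> finite_set (msupp mu).
Proof.
move=> _ _ hT mu_fin mu_radon mu_gt0 p1; split; last first.
  move=> /(finite_msupp_cone_sub _ _ _ _ hT mu_fin mu_radon p1)[eps [eps1 sub]].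
  by exists eps; split => //; right.
move=> [eps [eps1 cmp]]; apply: contrapT => infS.
set m := fine (mu setT).
have m0 : 0 < m by rewrite -lte_fin fine_measureK.
have e0 : 0 < (2 * eps) `^ p by rewrite powR_gt0//; lra.
(* The two terms are the bounds on [mu A] under which the first and the second inclusion fail. *)
pose delta := Num.min (m * (eps - 1) / (eps + 1)) (m / (2 * eps) `^ p).
have delta0 : 0 < delta.
  by rewrite lt_min !divr_gt0// ?mulr_gt0//; lra.
have [A [mA A0]] := msupp_small_measure _ _ _ hT mu_radon _ mu_fin infS delta0.
rewrite -fine_measureK// lte_fin lt_min ltr_pdivlMr ?ltr_pdivlMr//; last by lra.
move=> /andP[small1 small2]; case: cmp.
- by apply: (Lp_pos_not_sub_cone _ _ _ _ _ A) => //; exact: ltW.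
- by apply: (cone_not_sub_Lp_pos _ _ _ _ _ A) => //; exact: ltW.
Qed.
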